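(* For real $h$ with $|h|<1$ define $$Y(h)=\iint_{0<u<v<1}\frac{\mathrm{d}u\,\mathrm{d}v}{\sqrt{uv(1-u)(1-v)(1-uh)(1-(1-v)h)}}.$$ Then in a neighbourhood of $h=0$ the function $Y$ satisfies $$\Bigl(\theta_h^3-\tfrac12h(2\theta_h+1)(2\theta_h^2+2\theta_h+1)+h^2(\theta_h+1)^3\Bigr)Y(h)=-\frac{(4-4h-h^2)h}{(2-h)^2\sqrt{1-h}},$$ where $\theta_h=h\,\frac{\mathrm{d}}{\mathrm{d}h}$ and powers of $h$ act as multiplication operators. *)

(* Defs.v *)
From HB Require Import structures.
From mathcomp Require Import all_boot all_order all_algebra.
From mathcomp Require Import all_classical all_reals all_analysis.
Set Implicit Arguments. Unset Strict Implicit. Unset Printing Implicit Defensive.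
Import Order.TTheory GRing.Theory Num.Theory.
Import numFieldNormedType.Exports.
Local Open Scope classical_set_scope.
Local Open Scope ring_scope.

Definition triangle (R : realType) : set (R * R) :=
  [set p | 0 < p.1 /\ p.1 < p.2 /\ p.2 < 1].

Definition Yintegrand (R : realType) (h : R) (p : R * R) : R :=
  let u := p.1 in let v := p.2 in
  (Num.sqrt (u * v * (1 - u) * (1 - v) * (1 - u * h) * (1 - (1 - v) * h)))^-1.

Definition Y (R : realType) (h : R) : R :=
  fine (\int[((@lebesgue_measure R) \x (@lebesgue_measure R))%E]_(p in @triangle R)
          (Yintegrand h p)%:E)%E.

Definition theta (R : realType) (f : R -> R) : R -> R := fun h => h * derive1 f h.

Definition Lop (R : realType) (f : R -> R) : R -> R :=
  let t3 := theta (theta (theta f)) in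
  let A := fun h => 2 * theta (theta f) h + 2 * theta f h + f h in
  let A2 := fun h => 2 * theta A h + A h in
  let B1 := fun h => theta f h + f h in
  let B2 := fun h => theta B1 h + B1 h in
  let B3 := fun h => theta B2 h + B2 h in
  fun h => t3 h - 2^-1 * h * A2 h + h ^+ 2 * B3 h.

Definition rhs (R : realType) (h : R) : R :=
  - ((4 - 4 * h - h ^+ 2) * h) / ((2 - h) ^+ 2 * Num.sqrt (1 - h)).

(* Main.v *)
(* Put x = 1/(1 - uh), y = 1/(1 - (1 - v)h) and let F be the integrand of Y.
   Since theta x = x (x - 1), each theta^k F is F times a polynomial in x and y,
   and theta may be taken under the integral sign, so that L Y is a combination
   of the moments of x^i y^j against F.  The u-derivative of
   sqrt(u (1 - u)) x^(i + 1/2), multiplied by h, is the weight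
   sqrt(x / (u (1 - u))) times a polynomial in x, so integrating it first in u
   (Fubini) gives a relation between moments whose right-hand side is an
   integral along the diagonal u = v; the same holds in v.  The combination L Y
   is a combination of these relations, and the diagonal integrals, taken of
   x^(i + 1/2) y^(j + 1/2) over ]0, 1[, are elementary because
   1/x + 1/y = 2 - h there. *)
Require Import Defs.
From HB Require Import structures.
From mathcomp Require Import all_boot all_order all_algebra.
From mathcomp Require Import all_classical all_reals all_analysis.
From mathcomp Require Import measurable_realfun lebesgue_integral_under ring lra.
Import Order.TTheory GRing.Theory Num.Theory.
Import numFieldNormedType.Exports.
Local Open Scope classical_set_scope.
Local Open Scope ring_scope.

(** On this neighbourhood of 0, [1 - u * h] exceeds 1/2 for all [u] in [0, 1], which makes the
    estimates below uniform in [h]. *)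
Local Notation hdom := (`](-2^-1), 2^-1[).

(** * Integrability and the fundamental theorem on open intervals *)

Lemma derivable1_continuous (R : realType) (f : R -> R) (x : R) :
  derivable f x 1 -> {for x, continuous f}.
Proof. by move/derivable1_diffP/differentiable_continuous. Qed.

(** The open interval is exhausted by the compact intervals [S n]; on each one the integral is a
    difference of two values of [F], hence at most [2 * M], and monotone convergence passes to the
    limit. This allows [f] to blow up at both endpoints. *)
Lemma integrable_ge0_bounded_primitive (R : realType) (f F : R -> R) (a b M : R) :
  {in `]a, b[, continuous f} -> {in `]a, b[, forall x, 0 <= f x} ->
  {in `]a, b[, forall x : R, is_derive x 1 F (f x)} ->
  {in `]a, b[, forall x, `|F x| <= M} ->
  (@lebesgue_measure R).-integrable `]a, b[ (EFin \o f).
Proof.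
move=> cf f0 dF FM.
have [ba|ab] := leP b a.
  by rewrite set_itv_ge -?leNgt ?bnd_simp//; exact: integrable_set0.
have M0 : 0 <= M.
  by apply: le_trans (FM ((a + b) / 2) _) => //; rewrite in_itv/=; apply/andP; split; lra.
have mf : measurable_fun `]a, b[ f.
  by apply: open_continuous_measurable_fun => // x; rewrite inE; exact: cf.
apply/integrableP; split; first exact/measurable_EFinP.
pose S (n : nat) : set R := `[a + n.+1%:R^-1, b - n.+1%:R^-1]%classic.
have S_sub n x : S n x -> x \in `]a, b[.
  rewrite /S/= !in_itv/= => /andP[ax xb].
  have := ltr0Sn R n; rewrite -invr_gt0; move: n.+1%:R^-1 ax xb => e ax xb e0.
  by apply/andP; split; lra.
have -> : `]a, b[%classic = \bigcup_n S n.
  apply/seteqP; split=> [x /=|x [n _ /S_sub//]].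
  rewrite in_itv/= => /andP[ax xb].
  have m0 : 0 < Num.min (x - a) (b - x) by rewrite lt_min !subr_gt0 ax.
  have [n _ nm] := near_infty_natSinv_lt (PosNum m0).
  exists n => //; move: (nm n (leqnn n)) => /=; rewrite lt_min /S/= in_itv/=.
  by move: n.+1%:R^-1 => e /andP[? ?]; apply/andP; split; lra.
have nS : nondecreasing_seq S.
  move=> m n mn; rewrite subsetEset => x; rewrite /S/= !in_itv/=.
  have : n.+1%:R^-1 <= m.+1%:R^-1 :> R by rewrite lef_pV2 ?posrE ?ltr0n// ler_nat.
  by move: n.+1%:R^-1 m.+1%:R^-1 => e e' ? /andP[? ?]; apply/andP; split; lra.
have mS n : measurable (S n) by exact: measurable_itv.
have mfS n : measurable_fun (S n) (fun x => `|(EFin \o f) x|)%E.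
  apply: measurableT_comp => //; apply/measurable_EFinP.
  by apply: measurable_funS mf => // x /S_sub.
have := @ge0_nondecreasing_set_cvg_integral _ (measurableTypeR R) R S
    (fun x => `|(EFin \o f) x|)%E
  (@lebesgue_measure R) nS mS mfS (fun _ _ _ => abse_ge0 _).
move=> cv; apply: (@le_lt_trans _ _ (2 * M)%:E); last exact: ltry.
move/cvg_lim : (cv) => <- //; apply: lime_le; first by apply/cvg_ex; eexists; exact: cv.
apply: nearW => n.
(* For small [n] the set [S n] can be empty or a single point; the integral is then 0. *)
have [abn|ban] := ltP (a + n.+1%:R^-1) (b - n.+1%:R^-1); last first.
  have -> : (\int[lebesgue_measure]_(x in S n) `|(EFin \o f) x| = 0)%E.
    move: ban; rewrite le_eqVlt => /predU1P[ban|ban]; last first.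
      by rewrite /S set_itv_ge ?integral_set0// bnd_simp -ltNge.
    by rewrite /S ban set_itv1 integral_set1.
  by rewrite lee_fin mulr_ge0.
have -> : (\int[lebesgue_measure]_(x in S n) `|(EFin \o f) x|
    = \int[lebesgue_measure]_(x in S n) (f x)%:E)%E.
  apply: eq_integral; by move=> x /[!inE] /S_sub /f0 ? /=; rewrite ger0_norm.
have Sa : S n (a + n.+1%:R^-1) by rewrite /S/= in_itv/= lexx ltW.
have Sb : S n (b - n.+1%:R^-1) by rewrite /S/= in_itv/= lexx ltW.
rewrite (@continuous_FTC2 _ f F) //.
- have := FM _ (S_sub _ _ Sa); have := FM _ (S_sub _ _ Sb).
  by rewrite lee_fin !ler_norml => /andP[? ?] /andP[? ?]; lra.
- apply: continuous_in_subspaceT => x; rewrite inE => /S_sub; exact: cf.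
- split.
  + by move=> x /subset_itv_oo_cc/S_sub/dF [].
  + by apply: cvg_at_right_filter; apply: derivable1_continuous; case: (dF _ (S_sub _ _ Sa)).
  + by apply: cvg_at_left_filter; apply: derivable1_continuous; case: (dF _ (S_sub _ _ Sb)).
- move=> x /subset_itv_oo_cc/S_sub/dF ?; rewrite derive1E; exact: derive_val.
Qed.

(** A fundamental theorem for integrands that are singular at the endpoints. The indefinite integral
    [G] of the extension [p] of [f] by zero is continuous up to the endpoints and has the derivative
    of [F] inside, so the mean value theorem applied to [G - F] gives equal increments. *)
Lemma continuous_FTC2_oo (R : realType) (f F : R -> R) (a b : R) : a < b ->
  (@lebesgue_measure R).-integrable `]a, b[ (EFin \o f) ->
  {in `]a, b[, continuous f} ->
  {within `[a, b], continuous F} ->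
  {in `]a, b[, forall x : R, is_derive x 1 F (f x)} ->
  \int[@lebesgue_measure R]_(x in `]a, b[) f x = F b - F a.
Proof.
move=> ab fi cf cF dF.
set mu := @lebesgue_measure R.
pose p := f \_ `]a, b[.
have ip A : measurable A -> mu.-integrable A (EFin \o p).
  move=> mA; apply: (@integrableS _ _ _ mu setT A (EFin \o p)) => //.
  by rewrite /p -restrict_EFin; apply/(integrable_mkcond (mu := mu) (EFin \o f)).
pose G x := \int[mu]_(t in `[a, x]) p t.
have cG : {within `[a, b], continuous G}.
  by apply: (@parameterized_integral_continuous _ a b p);
      [exact: ltW|exact: (ip `[a, b]%classic (measurable_itv _))].
have dG x : x \in `]a, b[ -> is_derive x 1 G (f x).
  move=> xab; have := xab; rewrite in_itv/= => /andP[ax xb].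
  have cp : {for x, continuous p}.
    rewrite /prop_for /continuous_at {2}/p patchE mem_set//.
    apply: cvg_trans (cf _ xab); apply: near_eq_cvg; near=> y.
    rewrite /p patchE mem_set//=.
    near: y; exact: near_in_itvoo.
  have [dG GE] := @continuous_FTC1_closed _ p a x b xb (ip _ (measurable_itv _)) ax cp.
  apply: DeriveDef => //; rewrite -derive1E GE /p patchE mem_set//.
have [c cab] := @MVT _ (G - F) (fun=> 0) a b ab
  (fun x xab => is_derive_eq (is_deriveB (dG x xab) (dF x xab)) (subrr _))
  (within_continuousB cG cF).
rewrite mul0r /GRing.add/GRing.opp/= => /eqP.
rewrite subr_eq0 => /eqP.
have -> : G a = 0 by rewrite /G set_itv1 Rintegral_set1.
have -> : G b = \int[mu]_(x in `]a, b[) f x.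
  rewrite /G Rintegral_mkcond [RHS]Rintegral_mkcond; apply: eq_Rintegral => x _.
  rewrite /p !patchE; case: ifPn => //; rewrite notin_setE/= => nx.
  rewrite memNset//; by move=> /subset_itv_oo_cc.
by rewrite sub0r => /eqP; rewrite subr_eq => /eqP ->; rewrite addrC.
Unshelve. all: by end_near. Qed.

(** * Fubini on the triangle for products of one-variable functions *)

Lemma measurable_triangle (R : realType) :
  measurable (@triangle R : set (measurableTypeR R * measurableTypeR R)).
Proof.
have m1 : measurable_fun [set: measurableTypeR R * measurableTypeR R]
    (fst : _ -> measurableTypeR R) by exact: measurable_fst.
have m2 : measurable_fun [set: measurableTypeR R * measurableTypeR R]
    (snd : _ -> measurableTypeR R) by exact: measurable_snd.
have mlt (f g : measurableTypeR R * measurableTypeR R -> R) :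
    measurable_fun setT f -> measurable_fun setT g -> measurable [set p | f p < g p].
  move=> mf mg; have := measurable_fun_ltr mf mg => /(_ measurableT [set true] I).
  by rewrite setTI; congr (measurable _); apply/seteqP; split => p /=.
have -> : @triangle R = [set p | cst 0 p < p.1] `&` [set p | p.1 < p.2] `&` [set p | p.2 < cst 1 p].
  by apply/seteqP; split => [p [? [? ?]]|p [[? ?] ?]].
apply: measurableI; first apply: measurableI.
- by apply: mlt.
- by apply: mlt.
- by apply: mlt.
Qed.

(** By Tonelli: the iterated integral of the absolute value factors into two finite integrals. *)
Lemma integrable_prodM (R : realType) (a b : R -> R) :
  (@lebesgue_measure R).-integrable setT (EFin \o a) ->
  (@lebesgue_measure R).-integrable setT (EFin \o b) ->
  ((@lebesgue_measure R) \x (@lebesgue_measure R))%E.-integrable setT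
    (fun p => (a p.1 * b p.2)%:E).
Proof.
move=> ia ib; have /integrableP[ma fa] := ia; have /integrableP[mb fb] := ib.
apply/integrable12ltyP.
  apply/measurable_EFinP; apply: measurable_funM.
    by apply: measurableT_comp; [exact/measurable_EFinP|exact: measurable_fst].
  by apply: measurableT_comp; [exact/measurable_EFinP|exact: measurable_snd].
pose c := (\int[@lebesgue_measure R]_y `|(b y)%:E|)%E.
have E x : (\int[@lebesgue_measure R]_y `|(a (x, y).1 * b (x, y).2)%:E| = `|(a x)%:E| * c)%E.
  under eq_integral do rewrite /= normrM EFinM.
  by rewrite ge0_integralZl//; apply/measurable_EFinP;
      apply: measurableT_comp => //; exact/measurable_EFinP.
under eq_integral do rewrite E.
rewrite ge0_integralZr//; last 2 first.
- by apply/measurable_EFinP; apply: measurableT_comp => //; exact/measurable_EFinP.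
- exact: integral_ge0.
by apply: lte_mul_pinfty => //; [exact: integral_ge0| rewrite ge0_fin_numE//;
    exact: integral_ge0].
Qed.

Section triangle_fubini.
Context (R : realType) (a b : R -> R).
Notation mu := (@lebesgue_measure R).
Hypothesis ia : mu.-integrable `]0, 1[ (EFin \o a).
Hypothesis ib : mu.-integrable `]0, 1[ (EFin \o b).

Lemma integrable_triangle :
  (mu \x mu)%E.-integrable (@triangle R) (fun p => (a p.1 * b p.2)%:E).
Proof.
have p f : mu.-integrable `]0, 1[ (EFin \o f) -> mu.-integrable setT (EFin \o (f \_ `]0, 1[)).
  by move=> i; rewrite -restrict_EFin; apply/(integrable_mkcond (mu := mu) (EFin \o f)).
apply: eq_integrable (integrableS measurableT (@measurable_triangle R) (@subsetT _ _)
  (integrable_prodM _ _ _ (p _ ia) (p _ ib))).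
- exact: measurable_triangle.
- move=> [u v]; rewrite inE => -[/= u0 [uv v1]].
  by rewrite !patchE !mem_set//= in_itv/=; apply/andP; split => //; lra.
Qed.

Let f := (fun p : R * R => (a p.1 * b p.2)%:E) \_ (@triangle R).

Let intf : (mu \x mu)%E.-integrable setT f.
Proof. exact/(integrable_mkcond (mu :=
    (mu \x mu)%E) _ (@measurable_triangle R)).1/integrable_triangle. Qed.

(** The slice of the triangle at [v] is []0, v[] for [v] in ]0, 1[ and empty otherwise. This order
    of integration serves integrands that are derivatives in [u]; [triangle_fubini_fst] serves
    derivatives in [v]. *)
Lemma triangle_fubini_snd :
  \int[(mu \x mu)%E]_(p in @triangle R) (a p.1 * b p.2)
  = \int[mu]_(v in `]0, 1[) (b v * \int[mu]_(u in `]0, v[) a u).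
Proof.
rewrite /Rintegral; congr fine.
rewrite integral_mkcond -/f -(integral21_prod_meas1 intf) [RHS]integral_mkcond.
apply: eq_integral => v _; rewrite /fubini_G patchE; case: ifPn => [|nv].
  rewrite inE/= in_itv/= => /andP[v0 v1].
  have iv : mu.-integrable `]0, v[ (EFin \o a).
    apply: (integrableS _ _ _ ia) => //.
    by apply: subset_itvl; rewrite bnd_simp ltW.
  rewrite EFinM fineK; last exact: integrable_fin_num.
  rewrite muleC -integralZr// [RHS]integral_mkcond; apply: eq_integral => u _.
  rewrite /f !patchE; have [|] := boolP (u \in [set` `]0, v[]).
    rewrite inE/= in_itv/= => /andP[u0 uv]; rewrite mem_set//.
  rewrite notin_setE/= in_itv/= => /negP uv; rewrite memNset// => -[/= u0 [uv' _]].
  by rewrite u0 uv' in uv.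
rewrite integral0_eq// => u _; rewrite /f patchE memNset// => -[/= u0 [uv v1]].
by move: nv; rewrite notin_setE/= in_itv/= => /negP; rewrite v1 (lt_trans u0 uv).
Qed.

Lemma triangle_fubini_fst :
  \int[(mu \x mu)%E]_(p in @triangle R) (a p.1 * b p.2)
  = \int[mu]_(u in `]0, 1[) (a u * \int[mu]_(v in `]u, 1[) b v).
Proof.
rewrite /Rintegral; congr fine.
rewrite integral_mkcond -/f -(integral12_prod_meas1 intf) [RHS]integral_mkcond.
apply: eq_integral => u _; rewrite /fubini_F patchE; case: ifPn => [|nu].
  rewrite inE/= in_itv/= => /andP[u0 u1].
  have iu : mu.-integrable `]u, 1[ (EFin \o b).
    apply: (integrableS _ _ _ ib) => //.
    by apply: subset_itvr; rewrite bnd_simp ltW.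
  rewrite EFinM fineK; last exact: integrable_fin_num.
  rewrite -integralZl// [RHS]integral_mkcond; apply: eq_integral => v _.
  rewrite /f !patchE; have [|] := boolP (v \in [set` `]u, 1[]).
    rewrite inE/= in_itv/= => /andP[uv v1]; rewrite mem_set//.
  rewrite notin_setE/= in_itv/= => /negP uv; rewrite memNset// => -[/= _ [uv' v1]].
  by rewrite uv' v1 in uv.
rewrite integral0_eq// => v _; rewrite /f patchE memNset// => -[/= u0 [uv v1]].
by move: nu; rewrite notin_setE/= in_itv/= => /negP; rewrite u0 (lt_trans uv v1).
Qed.
End triangle_fubini.

(** * Derivatives of square roots *)

Lemma is_derive_sqrt_comp (R : realType) (f : R -> R) (x df : R) : 0 < f x ->
  is_derive x 1 f df ->
  is_derive x 1 (fun y => Num.sqrt (f y)) (df / (2 * Num.sqrt (f x))).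
Proof.
move=> f0 fd; have := is_derive1_comp (is_derive1_sqrt f0) fd.
by rewrite mulrC.
Qed.

Lemma is_derive_sqrtV (R : realType) (f : R -> R) (x df : R) : 0 < f x ->
  is_derive x 1 f df ->
  is_derive x 1 (fun y => (Num.sqrt (f y))^-1) (- df / (2 * f x * Num.sqrt (f x))).
Proof.
move=> f0 fd; have s0 : 0 < Num.sqrt (f x) by rewrite sqrtr_gt0.
have := @is_deriveV _ (fun y => Num.sqrt (f y)) x _ 1 (lt0r_neq0 s0)
    (is_derive_sqrt_comp _ _ _ _ f0 fd).
move/is_derive_eq; apply.
rewrite -[X in 2 * X * _](sqr_sqrtr (ltW f0)) /GRing.scale/=.
by field; rewrite lt0r_neq0.
Qed.

(* The integrand of [Y] is [kern h 0 u * kern h 0 (1 - v)]. *)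
Definition kern {R : realType} (h : R) (i : nat) (u : R) : R :=
  (1 - u * h)^-1 ^+ i * (Num.sqrt (u * (1 - u) * (1 - u * h)))^-1.

(** A majorant of 1 / sqrt(u (1 - u)), because sqrt(u) + sqrt(1 - u) is at least 1. As a sum it has
    the elementary bounded primitive 2 sqrt(u) - 2 sqrt(1 - u). *)
Definition ibound {R : realType} (u : R) : R :=
  (Num.sqrt u)^-1 + (Num.sqrt (1 - u))^-1.

(** * The integrable majorant and bounds on the kernel *)

Section kern.
Context {R : realType}.
Implicit Types (h u v : R) (i j : nat).
Notation mu := (@lebesgue_measure R).

Lemma ibound_ge0 u : 0 <= ibound u.
Proof. by rewrite addr_ge0// invr_ge0 sqrtr_ge0. Qed.

Lemma ibound_sub1 u : ibound (1 - u) = ibound u.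
Proof. by rewrite /ibound subKr addrC. Qed.

Lemma integrable_ibound : mu.-integrable `]0, 1[ (EFin \o ibound).
Proof.
have D u : u \in `]0, 1[ -> is_derive u 1
    (fun u : R => 2 * Num.sqrt u - 2 * Num.sqrt (1 - u)) (ibound u).
  rewrite in_itv/= => /andP[u0 u1].
  have su : 0 < Num.sqrt u by rewrite sqrtr_gt0.
  have su' : 0 < Num.sqrt (1 - u) by rewrite sqrtr_gt0 subr_gt0.
  have d1 := is_derive_sqrt_comp _ id u _ u0 (is_derive_id _ _).
  have d2 : is_derive u 1 (fun u : R => Num.sqrt (1 - u)) (- 1 / (2 * Num.sqrt (1 - u))).
    apply: (is_derive_sqrt_comp _ (fun u => 1 - u)); first lra.
    by apply: is_derive_eq; ring.
  apply: is_derive_eq; rewrite /ibound /GRing.scale/=.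
  by field; rewrite !lt0r_neq0.
apply: (integrable_ge0_bounded_primitive _ _ _ _ _ 2 _ _ D).
- move=> u; rewrite in_itv/= => /andP[u0 u1].
  have su : 0 < Num.sqrt u by rewrite sqrtr_gt0.
  have su' : 0 < Num.sqrt (1 - u) by rewrite sqrtr_gt0 subr_gt0.
  apply: (@cvgD _ R^o); apply: cvgV; rewrite ?lt0r_neq0//.
    exact: sqrt_continuous.
  apply: continuous_comp; last exact: sqrt_continuous.
  by apply: (@cvgB _ R^o); [exact: cvg_cst|exact: cvg_id].
- by move=> u _; exact: ibound_ge0.
- move=> u; rewrite in_itv/= => /andP[u0 u1].
  have a0 := sqrtr_ge0 u; have b0 := sqrtr_ge0 (1 - u).
  have a1 : Num.sqrt u <= 1 by rewrite -[leRHS]sqrtr1 ler_wsqrtr// ltW.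
  have b1 : Num.sqrt (1 - u) <= 1 by rewrite -[leRHS]sqrtr1 ler_wsqrtr//; lra.
  by rewrite ler_norml; apply/andP; split; lra.
Qed.

Lemma den_gt h u : h \in hdom -> u \in `[0, 1] -> 2^-1 < 1 - u * h.
Proof. rewrite !in_itv/= => /andP[h0 h1] /andP[u0 u1]; nra. Qed.

Lemma rad_gt0 h u : h \in hdom -> u \in `]0, 1[ ->
  0 < u * (1 - u) * (1 - u * h).
Proof.
move=> hI uI; have := den_gt h u hI (subset_itv_oo_cc uI).
by move: uI; rewrite in_itv/= => /andP[? ?] ?; rewrite !mulr_gt0 ?subr_gt0//; lra.
Qed.

Lemma kern_ge0 h i u : h \in hdom -> u \in `[0, 1] -> 0 <= kern h i u.
Proof.
move=> hI uI; have x := den_gt _ _ hI uI.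
by rewrite mulr_ge0// ?invr_ge0 ?sqrtr_ge0// exprn_ge0// invr_ge0; lra.
Qed.

(** The powers of 1 / (1 - u h) contribute at most [2 ^+ i]. With a, b, c the square roots of u, 1 -
    u and 1 - u h, the rest is 1 / (a b c), and it is at most 2 (1 / a + 1 / b) because a + b is at
    least 1 and c at least 1/2. *)
Lemma kern_le h i u : h \in hdom -> u \in `]0, 1[ ->
  kern h i u <= 2 ^+ i.+1 * ibound u.
Proof.
move=> hI uI; have x := den_gt _ _ hI (subset_itv_oo_cc uI).
have := uI; rewrite in_itv/= => /andP[u0 u1].
have -> : 2 ^+ i.+1 * ibound u = 2 ^+ i * (2 * ibound u) by rewrite exprS; ring.
apply: ler_pM; [by rewrite exprn_ge0// invr_ge0; lra|by rewrite invr_ge0 sqrtr_ge0| |].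
  by rewrite lerXn2r ?nnegrE ?invr_ge0; [|lra..|rewrite -[leRHS]invrK lef_pV2 ?posrE; lra].
have a0 : 0 < Num.sqrt u by rewrite sqrtr_gt0.
have b0 : 0 < Num.sqrt (1 - u) by rewrite sqrtr_gt0 subr_gt0.
have c0 : 0 < Num.sqrt (1 - u * h) by rewrite sqrtr_gt0; lra.
rewrite !sqrtrM ?mulr_ge0//; [|lra..].
have a2 := sqr_sqrtr (ltW u0).
have b2 : Num.sqrt (1 - u) ^+ 2 = 1 - u by rewrite sqr_sqrtr; lra.
have c2 : Num.sqrt (1 - u * h) ^+ 2 = 1 - u * h by rewrite sqr_sqrtr; lra.
rewrite /ibound; move: a0 b0 c0 a2 b2 c2.
move: (Num.sqrt u) (Num.sqrt (1 - u)) (Num.sqrt (1 - u * h)) => a b c a0 b0 c0 a2 b2 c2.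
have -> : 2 * (a^-1 + b^-1) = 2 * (a + b) * c * (a * b * c)^-1.
  by field; rewrite !lt0r_neq0.
rewrite ler_peMl ?invr_ge0 ?mulr_ge0 ?ltW//.
(* Here [a ^+ 2 + b ^+ 2 = 1] with [a] and [b] positive. *)
have ab1 : 1 <= a + b by nra.
have c1 : 2^-1 <= c by nra.
nra.
Qed.
End kern.

(** * Derivatives of the kernel in [h] and [u], and its continuity *)

Section kern.
Context {R : realType}.
Implicit Types (h u v : R) (i j : nat).
Notation mu := (@lebesgue_measure R).

Lemma is_derive_den_u h u : is_derive u 1 (fun u => 1 - u * h) (- h).
Proof.
have := is_deriveB (is_derive_cst (1 : R) u (1 : R))
    (is_deriveM (is_derive_id u (1 : R)) (is_derive_cst h u (1 : R))).
by move/is_derive_eq; apply; rewrite /GRing.scale/=; ring.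
Qed.

Lemma is_derive_den_h h u : is_derive h 1 (fun h => 1 - u * h) (- u).
Proof.
have := is_deriveB (is_derive_cst (1 : R) h (1 : R))
    (is_deriveM (is_derive_cst u h (1 : R)) (is_derive_id h (1 : R))).
by move/is_derive_eq; apply; rewrite /GRing.scale/=; ring.
Qed.

Lemma is_derive_1sub u : is_derive u 1 (fun u : R => 1 - u) (- 1).
Proof.
have := is_deriveB (is_derive_cst (1 : R) u (1 : R)) (is_derive_id u (1 : R)).
by move/is_derive_eq; apply; ring.
Qed.

Lemma is_derive_exprn_comp (f : R -> R) (x df : R) n : is_derive x 1 f df ->
  is_derive x 1 (fun y => f y ^+ n) (n%:R * f x ^+ n.-1 * df).
Proof.
move=> fd; have := is_deriveX n fd.
by have -> : f ^+ n = (fun y => f y ^+ n) by apply/funext => y; rewrite exprfctE.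
Qed.

(** With x = 1 / (1 - u h), the kernel is x^(i + 1/2) / sqrt(u (1 - u)), and x has [h]-derivative u
    x^2. *)
Lemma is_derive_kern_h h i u : h \in hdom -> u \in `]0, 1[ ->
  is_derive h 1 (fun h => kern h i u) ((i%:R + 2^-1) * u * kern h i.+1 u).
Proof.
move=> hI uI; have r0 := rad_gt0 _ _ hI uI.
have d0 := den_gt _ _ hI (subset_itv_oo_cc uI).
have n0 : 1 - u * h != 0 by rewrite lt0r_neq0//; lra.
have D1 := is_derive_exprn_comp (fun h => (1 - u * h)^-1) _ _ i (@is_deriveV _
    (fun h => 1 - u * h) _ _ _ n0 (is_derive_den_h h u)).
have Dr : is_derive h 1 (fun h => u * (1 - u) * (1 - u * h)) (u * (1 - u) * - u).
  have := is_deriveM (is_derive_cst (u * (1 - u)) h (1 : R)) (is_derive_den_h h u).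
  by move/is_derive_eq; apply; rewrite /GRing.scale/=; ring.
have D2 := is_derive_sqrtV _ (fun h => u * (1 - u) * (1 - u * h)) _ _ r0 Dr.
have := is_deriveM D1 D2; move/is_derive_eq; apply.
rewrite /kern /GRing.scale/=; move: uI; rewrite in_itv/= => /andP[u0 u1].
have s0 : Num.sqrt (u * (1 - u) * (1 - u * h)) != 0 by rewrite lt0r_neq0// sqrtr_gt0.
move: (Num.sqrt _) s0 => s s0.
(* The truncation of [i.-1] at [i = 0] is harmless, as the factor [i%:R] vanishes there. *)
have E : i%:R * (1 - u * h)^-1 ^+ i.-1 = i%:R * (1 - u * h)^-1 ^+ i * (1 - u * h).
  by case: i {D1} => [|i]; rewrite ?mul0r// exprS -mulrA mulrAC mulVf ?mul1r.
rewrite E [_ ^+ i.+1]exprS; move: (_ ^+ i) => xi.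
field; rewrite s0 !lt0r_neq0//; lra.
Qed.

(** The [u]-derivative of sqrt(u (1 - u)) x^(i + 1/2), in a form without division by [h], hence
    meaningful at [h = 0] too. *)
Definition kern_du h i u : R :=
  (2^-1 - u) * kern h i u + (i%:R + 2^-1) * h * u * (1 - u) * kern h i.+1 u.

(* On ]0, 1[ this is [u (1 - u) kern h i u], written so as to be continuous at
   the endpoints as well. *)
Definition prim h i u : R :=
  (1 - u * h)^-1 ^+ i * Num.sqrt (u * (1 - u) * (1 - u * h)^-1).

Lemma sqrt_prim h u : h \in hdom -> u \in `]0, 1[ ->
  Num.sqrt (u * (1 - u) * (1 - u * h)^-1)
  = u * (1 - u) * (Num.sqrt (u * (1 - u) * (1 - u * h)))^-1.
Proof.
move=> hI uI; have r0 := rad_gt0 _ _ hI uI.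
have d0 := den_gt _ _ hI (subset_itv_oo_cc uI).
have := uI; rewrite in_itv/= => /andP[u0 u1].
have uu0 : 0 < u * (1 - u) by rewrite mulr_gt0// subr_gt0.
apply/eqP; rewrite -(@eqrXn2 _ 2) ?sqrtr_ge0//; last first.
  by rewrite mulr_ge0 ?invr_ge0 ?sqrtr_ge0 ?ltW.
rewrite exprMn exprVn !sqr_sqrtr ?ltW// ?mulr_gt0// ?invr_gt0; [|lra..].
by apply/eqP; field; rewrite !lt0r_neq0; lra.
Qed.

Lemma primE h i u : h \in hdom -> u \in `]0, 1[ ->
  prim h i u = u * (1 - u) * kern h i u.
Proof. by move=> hI uI; rewrite /prim sqrt_prim// /kern mulrCA. Qed.

Lemma is_derive_prim h i u : h \in hdom -> u \in `]0, 1[ ->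
  is_derive u 1 (prim h i) (kern_du h i u).
Proof.
move=> hI uI; have r0 := rad_gt0 _ _ hI uI.
have d0 := den_gt _ _ hI (subset_itv_oo_cc uI).
have := uI; rewrite in_itv/= => /andP[u0 u1].
have uu0 : 0 < u * (1 - u) by rewrite mulr_gt0// subr_gt0.
have n0 : 1 - u * h != 0 by rewrite lt0r_neq0//; lra.
have DV := @is_deriveV _ (fun u => 1 - u * h) _ _ _ n0 (is_derive_den_u h u).
have D1 := is_derive_exprn_comp _ _ _ i DV.
have q0 : 0 < u * (1 - u) * (1 - u * h)^-1 by rewrite mulr_gt0// invr_gt0; lra.
have Dq := is_deriveM (is_deriveM (is_derive_id u (1 : R)) (is_derive_1sub u)) DV.
have D2 := is_derive_sqrt_comp _ (fun u => u * (1 - u) * (1 - u * h)^-1) _ _ q0 Dq.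
have := is_deriveM D1 D2; move/is_derive_eq; apply.
rewrite /kern_du /kern sqrt_prim// /GRing.scale/=.
have s0 : Num.sqrt (u * (1 - u) * (1 - u * h)) != 0 by rewrite lt0r_neq0// sqrtr_gt0.
have s2 := sqr_sqrtr (ltW r0).
move: (Num.sqrt _) s0 s2 => s s0 s2.
have E : i%:R * (1 - u * h)^-1 ^+ i.-1 = i%:R * (1 - u * h)^-1 ^+ i * (1 - u * h).
  by case: i {D1} => [|i]; rewrite ?mul0r// exprS -mulrA mulrAC mulVf ?mul1r.
(* The relation [s2] is used up here, so that [s] is a free variable in the final [field]. *)
have E2 : (2 * (u * (1 - u) * s^-1))^-1 = 2^-1 * (1 - u * h) * s^-1.
  have V : s^-1 = s / (u * (1 - u) * (1 - u * h)) by rewrite -s2; field.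
  by rewrite {1}V; field; rewrite s0 !lt0r_neq0//; lra.
rewrite E E2 [_ ^+ i.+1]exprS; move: (_ ^+ i) => xi.
have -> : ((id : R -> R) * (fun v => 1 - v)) u = u * (1 - u) by []. field;
    rewrite s0 !lt0r_neq0//; lra.
Qed.

(** The substitution h u = 1 - 1/x turns [h * kern_du] into a polynomial in x times a kernel. The
    factor 1/x lowers the index by one, so the derivative is taken at [i.+1]. *)
Lemma kern_duE h i u : h \in hdom -> u \in `]0, 1[ ->
  h * kern_du h i.+1 u = (i%:R + 3 / 2) * (h - 1) * kern h i.+2 u
     + (i%:R + 1) * (2 - h) * kern h i.+1 u - (i%:R + 2^-1) * kern h i u.
Proof.
move=> hI uI; have d0 := den_gt _ _ hI (subset_itv_oo_cc uI).
rewrite /kern_du /kern !exprS -natr1; move: (_ ^+ i) (Num.sqrt _)^-1 => xi s; field.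
by rewrite lt0r_neq0//; lra.
Qed.

(** Follows from h u x = x - 1. *)
Lemma kern_dhE h i u : h \in hdom -> u \in `]0, 1[ ->
  h * ((i%:R + 2^-1) * u * kern h i.+1 u)
  = (i%:R + 2^-1) * (kern h i.+1 u - kern h i u).
Proof.
move=> hI uI; have d0 := den_gt _ _ hI (subset_itv_oo_cc uI).
rewrite /kern !exprS; move: (_ ^+ i) (Num.sqrt _)^-1 => xi s; field.
by rewrite lt0r_neq0//; lra.
Qed.

Lemma continuous_x h i u : h \in hdom -> u \in `[0, 1] ->
  {for u, continuous (fun u => (1 - u * h)^-1 ^+ i)}.
Proof.
move=> hI uI; have d0 := den_gt _ _ hI uI.
have n0 : 1 - u * h != 0 by rewrite lt0r_neq0//; lra.
apply: derivable1_continuous.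
by case: (is_derive_exprn_comp (fun u => (1 - u * h)^-1) _ _ i (@is_deriveV _
    (fun u => 1 - u * h) _ _ _ n0 (is_derive_den_u h u))).
Qed.

Lemma continuous_kern h i u : h \in hdom -> u \in `]0, 1[ ->
  {for u, continuous (kern h i)}.
Proof.
move=> hI uI; have r0 := rad_gt0 _ _ hI uI.
have D := is_deriveM (is_deriveM (is_derive_id u (1 : R)) (is_derive_1sub u))
    (is_derive_den_u h u).
have cs : {for u, continuous (fun u => (Num.sqrt (u * (1 - u) * (1 - u * h)))^-1)}.
  apply: derivable1_continuous.
  by case: (is_derive_sqrtV _ (fun u => u * (1 - u) * (1 - u * h)) _ _ r0 D).
exact: (cvgM (continuous_x h i u hI (subset_itv_oo_cc uI)) cs).
Qed.

Lemma continuous_prim h i u : h \in hdom -> u \in `[0, 1] ->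
  {for u, continuous (prim h i)}.
Proof.
move=> hI uI; have d0 := den_gt _ _ hI uI.
have n0 : 1 - u * h != 0 by rewrite lt0r_neq0//; lra.
have D := is_deriveM (is_deriveM (is_derive_id u (1 : R)) (is_derive_1sub u))
  (@is_deriveV _ (fun u => 1 - u * h) _ _ _ n0 (is_derive_den_u h u)).
have cs : {for u, continuous (fun u => Num.sqrt (u * (1 - u) * (1 - u * h)^-1))}.
  apply: (@continuous_comp _ _ _ (fun u => u * (1 - u) * (1 - u * h)^-1));
      last exact: sqrt_continuous.
  by apply: derivable1_continuous; case: D.
exact: (cvgM (continuous_x h i u hI uI) cs).
Qed.

(** The singular endpoint contributes nothing to the integrals of [kern_du], so only the diagonal
    value survives. *)
Lemma prim0 h i : prim h i 0 = 0.
Proof. by rewrite /prim !mul0r sqrtr0 mulr0. Qed.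
End kern.

(** * Bilinearity of the triangle integral and integrability by domination *)

Section triangle_integral.
Context {R : realType}.
Notation mu := (@lebesgue_measure R).
Implicit Types (a b : R -> R) (c : R).

Definition tri_int a b : R :=
  \int[(mu \x mu)%E]_(p in @triangle R) (a p.1 * b p.2).

Lemma triangle_fst (p : R * R) : @triangle R p -> p.1 \in `]0, 1[.
Proof. by move=> [? [? ?]]; rewrite in_itv/=; apply/andP; split => //; lra. Qed.

Lemma triangle_snd (p : R * R) : @triangle R p -> p.2 \in `]0, 1[.
Proof. by move=> [? [? ?]]; rewrite in_itv/=; apply/andP; split => //; lra. Qed.

Lemma eq_tri_int a a' b b' : {in `]0, 1[, a =1 a'} -> {in `]0, 1[, b =1 b'} ->
  tri_int a b = tri_int a' b'.
Proof.
move=> aa bb; apply: eq_Rintegral => p; rewrite inE => tp.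
by rewrite aa ?triangle_fst// bb ?triangle_snd.
Qed.

Lemma tri_intDl a a' b : mu.-integrable `]0, 1[ (EFin \o a) ->
  mu.-integrable `]0, 1[ (EFin \o a') -> mu.-integrable `]0, 1[ (EFin \o b) ->
  tri_int (a \+ a') b = tri_int a b + tri_int a' b.
Proof.
move=> ia ia' ib; rewrite /tri_int -RintegralD;
    [|exact: measurable_triangle|exact: integrable_triangle..].
by apply: eq_Rintegral => p _; rewrite mulrDl.
Qed.

Lemma tri_intDr a b b' : mu.-integrable `]0, 1[ (EFin \o a) ->
  mu.-integrable `]0, 1[ (EFin \o b) -> mu.-integrable `]0, 1[ (EFin \o b') ->
  tri_int a (b \+ b') = tri_int a b + tri_int a b'.
Proof.
move=> ia ib ib'; rewrite /tri_int -RintegralD;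
    [|exact: measurable_triangle|exact: integrable_triangle..].
by apply: eq_Rintegral => p _; rewrite mulrDr.
Qed.

Lemma tri_intZl c a b : mu.-integrable `]0, 1[ (EFin \o a) ->
  mu.-integrable `]0, 1[ (EFin \o b) ->
  tri_int (c \*o a) b = c * tri_int a b.
Proof.
move=> ia ib; rewrite /tri_int -RintegralZl;
    [|exact: measurable_triangle|exact: integrable_triangle..].
by apply: eq_Rintegral => p _; rewrite mulrA.
Qed.

Lemma tri_intZr c a b : mu.-integrable `]0, 1[ (EFin \o a) ->
  mu.-integrable `]0, 1[ (EFin \o b) ->
  tri_int a (c \*o b) = c * tri_int a b.
Proof.
move=> ia ib; rewrite /tri_int -RintegralZl;
    [|exact: measurable_triangle|exact: integrable_triangle..].
by apply: eq_Rintegral => p _; rewrite mulrCA.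
Qed.

Lemma integrable_le_ibound a c : {in `]0, 1[, continuous a} ->
  {in `]0, 1[, forall u, `|a u| <= c * ibound u} ->
  mu.-integrable `]0, 1[ (EFin \o a).
Proof.
move=> ca ab.
apply: (@le_integrable _ _ _ mu _ (measurable_itv _) _ (EFin \o (fun u => c * ibound u))).
- apply/measurable_EFinP; apply: open_continuous_measurable_fun => //.
  by move=> x; rewrite inE; exact: ca.
- by move=> u /ab au /=; rewrite lee_fin (le_trans au)// ler_norm.
- have := @integrableZl _ _ _ mu _ (measurable_itv _) c _ integrable_ibound.
  by apply: eq_integrable.
Qed.

Lemma itv01_sub1 (u : R) : (1 - u \in `]0, 1[) = (u \in `]0, 1[).
Proof. by rewrite !in_itv/= subr_gt0 gtrBl andbC. Qed.

Lemma integrable_le_ibound_sub1 a c : {in `]0, 1[, continuous a} ->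
  {in `]0, 1[, forall u, `|a u| <= c * ibound u} ->
  mu.-integrable `]0, 1[ (EFin \o (fun v => a (1 - v))).
Proof.
move=> ca ab; apply: (integrable_le_ibound _ c) => u u01; last first.
  by rewrite -ibound_sub1 ab// itv01_sub1.
have c1 : {for u, continuous (fun v : R => 1 - v)}.
  by apply: derivable1_continuous; case: (is_derive_1sub u).
by apply: (continuous_comp c1); apply: ca; rewrite itv01_sub1.
Qed.
End triangle_integral.

(** * Integrability of the kernel and of its derivatives *)

Section kern_integrable.
Context {R : realType} (h : R) (hI : h \in hdom).
Notation mu := (@lebesgue_measure R).

Lemma kern_norm_le i (u : R) : u \in `]0, 1[ -> `|kern h i u| <= 2 ^+ i.+1 * ibound u.
Proof. by move=> uI; rewrite ger0_norm ?kern_ge0 ?kern_le// subset_itv_oo_cc. Qed.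

Definition kern_dh i (u : R) : R := (i%:R + 2^-1) * u * kern h i.+1 u.

Lemma kern_dh_norm_le i (u : R) : u \in `]0, 1[ ->
  `|kern_dh i u| <= (i%:R + 2^-1) * 2 ^+ i.+2 * ibound u.
Proof.
move=> uI; have := kern_norm_le i.+1 u uI; have := uI; rewrite in_itv/= => /andP[u0 u1].
have ci : 0 <= i%:R + 2^-1 :> R by rewrite addr_ge0 ?ler0n.
rewrite /kern_dh; move: (kern h i.+1 u) (2 ^+ i.+2) => k e kl;
    rewrite -!mulrA !normrM (ger0_norm ci) (gtr0_norm u0).
apply: ler_wpM2l => //; apply: le_trans kl.
by rewrite ler_piMl// ltW.
Qed.

Lemma kern_du_norm_le i (u : R) : u \in `]0, 1[ ->
  `|kern_du h i u| <= (2 ^+ i.+1 + (i%:R + 2^-1) * 2 ^+ i.+2) * ibound u.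
Proof.
move=> uI; have k1 := kern_norm_le i u uI; have k2 := kern_norm_le i.+1 u uI.
have := uI; rewrite in_itv/= => /andP[u0 u1].
have ci : 0 <= i%:R + 2^-1 :> R by rewrite addr_ge0 ?ler0n.
rewrite /kern_du [leRHS]mulrDl;
    move: (kern h i u) (kern h i.+1 u) (2 ^+ i.+1) (2 ^+ i.+2) k1 k2 => a b e e' k1 k2.
apply: (le_trans (ler_normD _ _)); apply: lerD.
  rewrite normrM; apply: le_trans k1; rewrite ler_piMl//.
  by rewrite ler_norml; apply/andP; split; lra.
rewrite -!mulrA normrM (ger0_norm ci); apply: ler_wpM2l => //.
rewrite !mulrA normrM; apply: le_trans k2; rewrite ler_piMl//.
have : `|h| <= 2^-1 by move: hI; rewrite in_itv/= ler_norml => /andP[? ?];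
    apply/andP; split; lra.
have v0 : 0 < 1 - u by lra.
rewrite !normrM (gtr0_norm u0) (gtr0_norm v0) => h1.
have : u * (1 - u) <= 1 by nra.
have := normr_ge0 h; move: `|h| h1 => H h1 h0 uu; rewrite -mulrA.
have uu0 : 0 <= u * (1 - u) by nra.
nra.
Qed.

Lemma continuous_kern_dh i : {in `]0, 1[, continuous (kern_dh i)}.
Proof.
move=> u uI; apply: (@cvgM); last exact: continuous_kern.
by apply: (@cvgM); [exact: cvg_cst|exact: cvg_id].
Qed.

Lemma continuous_kern_du i : {in `]0, 1[, continuous (kern_du h i)}.
Proof.
move=> u uI; apply: (@cvgD _ R^o).
  apply: (@cvgM); last exact: continuous_kern.
  by apply: (@cvgB _ R^o); [exact: cvg_cst|exact: cvg_id].
apply: (@cvgM); last exact: continuous_kern.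
apply: (@cvgM); first by apply: cvgM; [exact: cvg_cst|exact: cvg_id].
by apply: (@cvgB _ R^o); [exact: cvg_cst|exact: cvg_id].
Qed.

Lemma integrable_kern i : mu.-integrable `]0, 1[ (EFin \o kern h i).
Proof.
apply: (integrable_le_ibound _ (2 ^+ i.+1)) => u uI; first exact: continuous_kern.
exact: kern_norm_le.
Qed.

Lemma integrable_kern_sub1 i :
  mu.-integrable `]0, 1[ (EFin \o (fun v => kern h i (1 - v))).
Proof.
apply: (integrable_le_ibound_sub1 _ (2 ^+ i.+1)) => u uI; first exact: continuous_kern.
exact: kern_norm_le.
Qed.

Lemma integrable_kern_dh i : mu.-integrable `]0, 1[ (EFin \o kern_dh i).
Proof. exact: integrable_le_ibound (continuous_kern_dh i) (kern_dh_norm_le i). Qed.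

Lemma integrable_kern_dh_sub1 i :
  mu.-integrable `]0, 1[ (EFin \o (fun v => kern_dh i (1 - v))).
Proof. exact: integrable_le_ibound_sub1 (continuous_kern_dh i) (kern_dh_norm_le i). Qed.

Lemma integrable_kern_du i : mu.-integrable `]0, 1[ (EFin \o kern_du h i).
Proof. exact: integrable_le_ibound (continuous_kern_du i) (kern_du_norm_le i). Qed.

Lemma integrable_kern_du_sub1 i :
  mu.-integrable `]0, 1[ (EFin \o (fun v => kern_du h i (1 - v))).
Proof. exact: integrable_le_ibound_sub1 (continuous_kern_du i) (kern_du_norm_le i). Qed.

End kern_integrable.

(** * Moments: differentiation in [h] and integration by parts *)

Section moments.
Context {R : realType}.
Notation mu := (@lebesgue_measure R).
Implicit Types (h u v : R) (i j : nat).

(** The moment of x^i y^j against the integrand of [Y], whose half powers of x and y are already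
    part of the kernels. *)
Definition moment i j h : R := tri_int (kern h i) (fun v => kern h j (1 - v)).

(** Differentiation under the integral sign: throughout [hdom] the [h]-derivative of the integrand
    is dominated by the integrable function [G]. *)
Lemma is_derive_moment i j h : h \in hdom ->
  is_derive h 1 (moment i j)
    (tri_int (kern_dh h i) (fun v => kern h j (1 - v))
     + tri_int (kern h i) (fun v => kern_dh h j (1 - v))).
Proof.
move=> hI.
pose f h (p : R * R) := kern h i p.1 * kern h j (1 - p.2).
pose df h (p : R * R) :=
  kern_dh h i p.1 * kern h j (1 - p.2) + kern h i p.1 * kern_dh h j (1 - p.2).
have Df (x : R) p : x \in hdom -> @triangle R p -> is_derive x 1 (f^~ p) (df x p).
  move=> xI tp; have p1 := triangle_fst _ tp.
  have p2 : 1 - p.2 \in `]0, 1[ by rewrite itv01_sub1 triangle_snd.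
  have := is_deriveM (is_derive_kern_h _ i _ xI p1) (is_derive_kern_h _ j _ xI p2).
  by move/is_derive_eq; apply; rewrite /df /kern_dh /GRing.scale/=; ring.
(* One summand for each term of the product rule: a constant of [kern_dh_norm_le] times a constant
   of [kern_norm_le]. The symmetry [ibound_sub1] lets [ibound p.2] bound the factors taken at
   [1 - p.2]. *)
pose c : R := (i%:R + 2^-1) * 2 ^+ i.+2 * 2 ^+ j.+1 + 2 ^+ i.+1 * ((j%:R + 2^-1) * 2 ^+ j.+2).
pose G (p : R * R) := c * (ibound p.1 * ibound p.2).
have ci k : 0 <= k%:R + 2^-1 :> R by rewrite addr_ge0 ?ler0n.
have c0 : 0 <= c by rewrite addr_ge0// !mulr_ge0// exprn_ge0.
have intf x : `](-2^-1), 2^-1[%classic x ->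
    (mu \x mu)%E.-integrable (@triangle R) (EFin \o f x).
  move=> xI.
  exact: (integrable_triangle _ _ _ (integrable_kern x xI i) (integrable_kern_sub1 x xI j)).
have d1E x p : `](-2^-1), 2^-1[%classic x -> @triangle R p -> partial1of2 f x p = df x p.
  by move=> xI tp; have D := Df _ _ xI tp; rewrite partial1of2E; exact: derive_val.
have derf x p : `](-2^-1), 2^-1[%classic x -> @triangle R p -> derivable (f^~ p) x 1.
  by move=> xI tp; case: (Df _ _ xI tp).
have G0 p : 0 <= G p by rewrite mulr_ge0// mulr_ge0 ?ibound_ge0.
have intG : (mu \x mu)%E.-integrable (@triangle R) (EFin \o G).
  have := @integrableZl _ _ _ (mu \x mu)%E _ (@measurable_triangle R) c _
    (integrable_triangle _ _ _ integrable_ibound integrable_ibound).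
  by apply: eq_integrable => //; exact: measurable_triangle.
have Gub x p : `](-2^-1), 2^-1[%classic x -> @triangle R p -> `|partial1of2 f x p| <= G p.
  move=> xI tp; rewrite d1E//; have p1 := triangle_fst _ tp.
  have p2 : 1 - p.2 \in `]0, 1[ by rewrite itv01_sub1 triangle_snd.
  have k1 := kern_norm_le _ xI i _ p1; have k2 := kern_norm_le _ xI j _ p2.
  have d1 := kern_dh_norm_le _ xI i _ p1; have d2 := kern_dh_norm_le _ xI j _ p2.
  rewrite ibound_sub1 in k2 d2.
  apply: (le_trans (ler_normD _ _)).
  have -> : G p = (i%:R + 2^-1) * 2 ^+ i.+2 * ibound p.1 * (2 ^+ j.+1 * ibound p.2)
    + 2 ^+ i.+1 * ibound p.1 * ((j%:R + 2^-1) * 2 ^+ j.+2 * ibound p.2).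
    rewrite /G /c; move: (2 ^+ i.+1) (2 ^+ i.+2) (2 ^+ j.+1) (2 ^+ j.+2) => ? ? ? ?; ring.
  by apply: lerD; rewrite [leLHS]normrM ler_pM.
have hI' : `](-2^-1), 2^-1[%classic h by [].
have der := @derivable_under_integral R _ _ (mu \x mu)%E f _ (@measurable_triangle R)
  h _ _ hI' intf derf G G0 intG Gub.
have val := @differentiation_under_integral R _ _ (mu \x mu)%E f _ (@measurable_triangle R)
  h _ _ hI' intf derf G G0 intG Gub.
apply: DeriveDef; first exact: der.
rewrite -derive1E [LHS]val /tri_int -RintegralD.
- by apply: eq_Rintegral => p; rewrite inE => tp; exact: d1E.
- exact: measurable_triangle.
- exact: (integrable_triangle _ _ _ (integrable_kern_dh h hI i) (integrable_kern_sub1 h hI j)).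
- exact: (integrable_triangle _ _ _ (integrable_kern h hI i) (integrable_kern_dh_sub1 h hI j)).
Qed.

(** By [kern_dhE], theta multiplies x^(i + 1/2) by (i + 1/2) (x - 1), and similarly for y. *)
Lemma theta_moment i j h : h \in hdom ->
  theta (moment i j) h = (i%:R + 2^-1) * (moment i.+1 j h - moment i j h)
                  + (j%:R + 2^-1) * (moment i j.+1 h - moment i j h).
Proof.
move=> hI; have D := is_derive_moment i j h hI.
rewrite /theta derive1E derive_val mulrDr.
have ik k := integrable_kern h hI k; have ik1 k := integrable_kern_sub1 h hI k.
rewrite -tri_intZl; [|exact: integrable_kern_dh|by []].
rewrite -tri_intZr; [|by []|exact: integrable_kern_dh_sub1].
have iB k : mu.-integrable `]0, 1[ (EFin \o (-1 \*o kern h k)).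
  exact: (@integrableZl _ _ _ mu _ (measurable_itv _) (-1) _ (ik k)).
have iB1 k : mu.-integrable `]0, 1[ (EFin \o (-1 \*o (fun v => kern h k (1 - v)))).
  exact: (@integrableZl _ _ _ mu _ (measurable_itv _) (-1) _ (ik1 k)).
rewrite (@eq_tri_int _ _ ((i%:R + 2^-1) \*o (kern h i.+1 \+ (-1 \*o kern h i)))
  _ (fun v => kern h j (1 - v))) //; last first.
  by move=> u uI; rewrite /= /kern_dh kern_dhE//= mulN1r.
rewrite (@eq_tri_int _ (kern h i) (kern h i) (h \*o
    (fun v => kern_dh h j (1 - v))) ((j%:R + 2^-1) \*o ((fun v => kern h j.+1 (1 - v))
    \+ (-1 \*o (fun v => kern h j (1 - v)))))) //; last first.
  by move=> u uI; rewrite /= /kern_dh kern_dhE ?itv01_sub1//= mulN1r.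
rewrite tri_intZl//; last exact: (@integrableD _ _ _ mu _ (measurable_itv _) _ _ (ik _) (iB _)).
rewrite tri_intZr//; last exact: (@integrableD _ _ _ mu _ (measurable_itv _) _
    _ (ik1 _) (iB1 _)).
rewrite tri_intDl// tri_intDr// tri_intZl// tri_intZr//.
by rewrite !mulN1r.
Qed.

(** The restriction of x^(i + 1/2) y^(j + 1/2) to the diagonal u = v. *)
Definition bdry h i j v : R :=
  (1 - v * h)^-1 ^+ i * (1 - (1 - v) * h)^-1 ^+ j
  * (Num.sqrt ((1 - v * h) * (1 - (1 - v) * h)))^-1.

(** Each kernel carries 1 / sqrt(v (1 - v)); the factor v (1 - v) coming from [prim] cancels both,
    so the diagonal integrand has no singularity. *)
Lemma bdryE h i j v : h \in hdom -> v \in `]0, 1[ ->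
  v * (1 - v) * kern h i v * kern h j (1 - v) = bdry h i j v.
Proof.
move=> hI vI; have vI' : 1 - v \in `]0, 1[ by rewrite itv01_sub1.
have d0 := den_gt _ _ hI (subset_itv_oo_cc vI).
have d1 := den_gt _ _ hI (subset_itv_oo_cc vI').
have := vI; rewrite in_itv/= => /andP[v0 v1].
have w0 : 0 < v * (1 - v) by rewrite mulr_gt0// subr_gt0.
rewrite /kern /bdry subKr [(1 - v) * v]mulrC.
rewrite ![Num.sqrt (v * (1 - v) * _)]sqrtrM ?ltW// [in RHS]sqrtrM; last lra.
have s2 := sqr_sqrtr (ltW w0).
have s0 : 0 < Num.sqrt (v * (1 - v)) by rewrite sqrtr_gt0.
rewrite -{1}s2; move: (Num.sqrt (v * (1 - v))) s0 => s s0.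
have a0 : 0 < Num.sqrt (1 - v * h) by rewrite sqrtr_gt0; lra.
have b0 : 0 < Num.sqrt (1 - (1 - v) * h) by rewrite sqrtr_gt0; lra.
move: (Num.sqrt _) (Num.sqrt _) a0 b0 => a b a0 b0.
move: (_ ^+ i) (_ ^+ j) => xi yj.
by field; rewrite !lt0r_neq0.
Qed.

Lemma int_kern_du_left h i v : h \in hdom -> v \in `]0, 1[ ->
  \int[mu]_(u in `]0, v[) kern_du h i u = prim h i v.
Proof.
move=> hI; rewrite in_itv/= => /andP[v0 v1].
have sub : `]0, v[ `<=` `]0, 1[%classic by apply: subset_itvl; rewrite bnd_simp ltW.
rewrite (@continuous_FTC2_oo _ _ (prim h i)) ?prim0 ?subr0//.
- by apply: (@integrableS _ _ _ mu `]0, 1[) => //; exact: integrable_kern_du.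
- by move=> u /sub; exact: continuous_kern_du.
- apply: continuous_in_subspaceT => u; rewrite inE/= in_itv/= => /andP[u0 uv].
  by apply: continuous_prim => //; rewrite in_itv/= u0 (le_trans uv)// ltW.
- by move=> u /sub; exact: is_derive_prim.
Qed.

(** The primitive [- prim h i (1 - v)] vanishes at [v = 1]. Its sign cancels that of the lower
    limit, so the diagonal term enters with the same sign as in [int_kern_du_left]. *)
Lemma int_kern_du_right h i u : h \in hdom -> u \in `]0, 1[ ->
  \int[mu]_(v in `]u, 1[) kern_du h i (1 - v) = prim h i (1 - u).
Proof.
move=> hI; rewrite in_itv/= => /andP[u0 u1].
have sub : `]u, 1[ `<=` `]0, 1[%classic by apply: subset_itvr; rewrite bnd_simp ltW.
have c1 v : {for v, continuous (fun v : R => 1 - v)}.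
  by apply: derivable1_continuous; case: (is_derive_1sub v).
rewrite (@continuous_FTC2_oo _ _ (fun v => - prim h i (1 - v))) ?subrr ?prim0 ?oppr0 ?sub0r
    ?opprK//.
- by apply: (@integrableS _ _ _ mu `]0, 1[) => //; exact: integrable_kern_du_sub1.
- move=> v /sub vI; apply: (continuous_comp (c1 v)).
  by apply: continuous_kern_du; rewrite ?itv01_sub1.
- apply: continuous_in_subspaceT => v; rewrite inE/= in_itv/= => /andP[uv v1].
  apply: (@cvgN _ R^o); apply: (continuous_comp (c1 v)).
  by apply: continuous_prim => //; rewrite in_itv/= subr_ge0 v1/=; lra.
- move=> v /sub vI; have vI' : 1 - v \in `]0, 1[ by rewrite itv01_sub1.
  have := is_deriveN (@is_derive1_comp _ (prim h i) (fun v => 1 - v) _ _ _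
    (is_derive_prim _ i _ hI vI') (is_derive_1sub v)).
  by move/is_derive_eq; apply; rewrite mulrN1 opprK.
Qed.

(** The integral of [h * kern_du h i.+1 u * kern h j (1 - v)] is computed twice: by expanding with
    [kern_duE], which gives moments, and by integrating first in [u], which leaves the diagonal. *)
Lemma moment_rel_fst i j h : h \in hdom ->
  (i%:R + 3 / 2) * (h - 1) * moment i.+2 j h + (i%:R + 1) * (2 - h) * moment i.+1 j h
    - (i%:R + 2^-1) * moment i j h
  = h * \int[mu]_(v in `]0, 1[) bdry h i.+1 j v.
Proof.
move=> hI.
have ik k := integrable_kern h hI k; have ik1 k := integrable_kern_sub1 h hI k.
have iZ c k : mu.-integrable `]0, 1[ (EFin \o (c \*o kern h k)).
  exact: (@integrableZl _ _ _ mu _ (measurable_itv _) c _ (ik k)).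
have -> : \int[mu]_(v in `]0, 1[) bdry h i.+1 j v
    = tri_int (kern_du h i.+1) (fun v => kern h j (1 - v)).
  apply: (etrans _ (esym (triangle_fubini_snd _ _ _ (integrable_kern_du h hI i.+1) (ik1 j)))).
  apply: eq_Rintegral => v; rewrite inE => vI.
  by rewrite int_kern_du_left// primE// -bdryE// mulrC.
rewrite -tri_intZl//; last exact: integrable_kern_du.
rewrite (@eq_tri_int _ (h \*o _) (((((i%:R + 3 / 2) * (h - 1)) \*o kern h i.+2)
   \+ (((i%:R + 1) * (2 - h)) \*o kern h i.+1))
       \+ ((- (i%:R + 2^-1)) \*o kern h i)) _ (fun v => kern h j (1 - v)))//; last first.
  by move=> u uI; rewrite /= kern_duE// mulNr.
rewrite tri_intDl//; last first.
  exact: (@integrableD _ _ _ mu _ (measurable_itv _) _ _ (iZ _ _) (iZ _ _)).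
by rewrite tri_intDl// !tri_intZl// mulNr.
Qed.

Lemma moment_rel_snd i j h : h \in hdom ->
  (j%:R + 3 / 2) * (h - 1) * moment i j.+2 h + (j%:R + 1) * (2 - h) * moment i j.+1 h
    - (j%:R + 2^-1) * moment i j h
  = h * \int[mu]_(v in `]0, 1[) bdry h i j.+1 v.
Proof.
move=> hI.
have ik k := integrable_kern h hI k; have ik1 k := integrable_kern_sub1 h hI k.
have iZ c k : mu.-integrable `]0, 1[ (EFin \o (c \*o (fun v => kern h k (1 - v)))).
  exact: (@integrableZl _ _ _ mu _ (measurable_itv _) c _ (ik1 k)).
have -> : \int[mu]_(v in `]0, 1[) bdry h i j.+1 v
    = tri_int (kern h i) (fun v => kern_du h j.+1 (1 - v)).
  apply: (etrans _ (esym (triangle_fubini_fst _ _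
      _ (ik i) (integrable_kern_du_sub1 h hI j.+1)))).
  apply: eq_Rintegral => v; rewrite inE => vI.
  rewrite int_kern_du_right// primE ?itv01_sub1// subKr -bdryE//.
  by ring.
rewrite -tri_intZr//; last exact: integrable_kern_du_sub1.
rewrite (@eq_tri_int _ (kern h i) (kern h i) (h \*o _) (((((j%:R + 3 / 2) * (h - 1)) \*o
    (fun v => kern h j.+2 (1 - v)))
   \+ (((j%:R + 1) * (2 - h)) \*o (fun v => kern h j.+1 (1 - v))))
       \+ ((- (j%:R + 2^-1)) \*o (fun v => kern h j (1 - v)))))//; last first.
  by move=> u uI; rewrite /= kern_duE ?itv01_sub1// mulNr.
rewrite tri_intDr//; last first.
  exact: (@integrableD _ _ _ mu _ (measurable_itv _) _ _ (iZ _ _) (iZ _ _)).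
by rewrite tri_intDr// !tri_intZr// mulNr.
Qed.
End moments.

(** * Elementary integrals along the diagonal *)

Section boundary.
Context {R : realType}.
Notation mu := (@lebesgue_measure R).
Implicit Types (h u v : R) (i j : nat).

Lemma integrable_continuous01 (f : R -> R) :
  {in `[0, 1], continuous f} -> mu.-integrable `]0, 1[ (EFin \o f).
Proof.
move=> cf; apply: (@integrableS _ _ _ mu `[0, 1]) => //.
  exact: subset_itv_oo_cc.
apply: continuous_compact_integrable; first exact: segment_compact.
by apply: continuous_in_subspaceT => x; rewrite inE; exact: cf.
Qed.

Definition bdry_den h v : R := (1 - v * h) * (1 - (1 - v) * h).

Lemma itv01cc_sub1 (u : R) : (1 - u \in `[0, 1]) = (u \in `[0, 1]).
Proof. by rewrite !in_itv/= subr_ge0 gerBl andbC. Qed.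

Lemma bdry_den_gt0 h v : h \in hdom -> v \in `[0, 1] -> 0 < bdry_den h v.
Proof.
move=> hI vI; have vI' : 1 - v \in `[0, 1] by rewrite itv01cc_sub1.
by have := den_gt _ _ hI vI; have := den_gt _ _ hI vI' => ? ?; rewrite mulr_gt0//; lra.
Qed.

Lemma is_derive_bdry_den h v :
  is_derive v 1 (bdry_den h) (h ^+ 2 * (1 - 2 * v)).
Proof.
have D2 : is_derive v 1 (fun v => 1 - (1 - v) * h) h.
  have := @is_derive1_comp _ (fun u => 1 - u * h) (fun v => 1 - v) _ _ _
    (is_derive_den_u h (1 - v)) (is_derive_1sub v).
  by move/is_derive_eq; apply; ring.
have := is_deriveM (is_derive_den_u h v) D2.
by move/is_derive_eq; apply; rewrite /GRing.scale/=; ring.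
Qed.

Definition bdry_w h v : R := (Num.sqrt (bdry_den h v))^-1.

Lemma sqr_bdry_w h v : h \in hdom -> v \in `[0, 1] ->
  bdry_w h v ^+ 2 * bdry_den h v = 1.
Proof.
move=> hI vI; have d0 := bdry_den_gt0 h v hI vI.
by rewrite exprVn sqr_sqrtr ?ltW// mulVf// lt0r_neq0.
Qed.

Lemma is_derive_bdry_w h v : h \in hdom -> v \in `[0, 1] ->
  is_derive v 1 (bdry_w h) (h ^+ 2 * (v - 2^-1) * bdry_w h v ^+ 3).
Proof.
move=> hI vI; have d0 := bdry_den_gt0 h v hI vI.
have := is_derive_sqrtV _ _ _ _ d0 (is_derive_bdry_den h v).
move/is_derive_eq; apply.
have s0 : 0 < Num.sqrt (bdry_den h v) by rewrite sqrtr_gt0.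
rewrite /bdry_w -{1}(sqr_sqrtr (ltW d0)); move: (Num.sqrt _) s0 => s s0.
by field; rewrite lt0r_neq0.
Qed.

Lemma continuous_bdry_w h v : h \in hdom -> v \in `[0, 1] ->
  {for v, continuous (bdry_w h)}.
Proof.
by move=> hI vI; apply: derivable1_continuous; case: (is_derive_bdry_w h v hI vI).
Qed.

Lemma integrable_bdry h i j : h \in hdom ->
  mu.-integrable `]0, 1[ (EFin \o bdry h i j).
Proof.
move=> hI; apply: integrable_continuous01 => v vI.
have vI' : 1 - v \in `[0, 1] by rewrite itv01cc_sub1.
have c1 : {for v, continuous (fun v : R => 1 - v)}.
  by apply: derivable1_continuous; case: (is_derive_1sub v).
apply: (cvgM (cvgM (continuous_x h i v hI vI) _) (continuous_bdry_w h v hI vI)).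
exact: (continuous_comp c1 (continuous_x h j (1 - v) hI vI')).
Qed.

(* Both [(v - 1/2) w] and [(v - 1/2) w^3] have derivatives that are polynomial
   in [w], because [bdry_den h v = (1 - h/2)^2 - h^2 (v - 1/2)^2]. *)
Lemma integral_bdry_w h (p q : R) : h \in hdom ->
  \int[mu]_(v in `]0, 1[) ((p * ((2 - h) ^+ 2 / 4) - 2 * q) * bdry_w h v ^+ 3
     + q * (3 * (2 - h) ^+ 2 / 4) * bdry_w h v ^+ 5)
  = p * (Num.sqrt (1 - h))^-1 + q * (Num.sqrt (1 - h))^-1 ^+ 3.
Proof.
move=> hI.
pose H v := p * ((v - 2^-1) * bdry_w h v) + q * ((v - 2^-1) * bdry_w h v ^+ 3).
have DH v : v \in `[0, 1] -> is_derive v 1 H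
   ((p * ((2 - h) ^+ 2 / 4) - 2 * q) * bdry_w h v ^+ 3
     + q * (3 * (2 - h) ^+ 2 / 4) * bdry_w h v ^+ 5).
  move=> vI; have Dw := is_derive_bdry_w h v hI vI.
  have Dw3 := is_derive_exprn_comp _ _ _ 3 Dw.
  have Dt : is_derive v 1 (fun v : R => v - 2^-1) 1.
    have := is_deriveB (is_derive_id v (1 : R)) (is_derive_cst (2^-1 : R) v (1 : R)).
    by move/is_derive_eq; apply; rewrite subr0.
  have := is_deriveD (is_deriveM (is_derive_cst p v (1 : R)) (is_deriveM Dt Dw))
    (is_deriveM (is_derive_cst q v (1 : R)) (is_deriveM Dt Dw3)).
  move/is_derive_eq; apply; rewrite /GRing.scale/=.
  have : bdry_w h v ^+ 2 * ((2 - h) ^+ 2 / 4 - h ^+ 2 * (v - 2^-1) ^+ 2) = 1.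
    by rewrite -[RHS](sqr_bdry_w h v hI vI) /bdry_den; field.
  move: (bdry_w h v) => w E.
  (* The derivative and the target agree only modulo the relation [E]; the intermediate expression
     displays their difference as a multiple of it. *)
  apply: (@etrans _ _ ((p * ((2 - h) ^+ 2 / 4) - 2 * q) * w ^+ 3
     + q * (3 * (2 - h) ^+ 2 / 4) * w ^+ 5 + (p * w + 3 * q * w ^+ 3)
       * (1 - w ^+ 2 * ((2 - h) ^+ 2 / 4 - h ^+ 2 * (v - 2^-1) ^+ 2)))).
    by field.
  by rewrite E subrr mulr0 addr0.
have cf v : v \in `[0, 1] -> {for v, continuous (fun v =>
   (p * ((2 - h) ^+ 2 / 4) - 2 * q) * bdry_w h v ^+ 3
     + q * (3 * (2 - h) ^+ 2 / 4) * bdry_w h v ^+ 5)}.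
  move=> vI; have Dw := is_derive_bdry_w h v hI vI.
  apply: derivable1_continuous.
  by case: (is_deriveD
    (is_deriveM (is_derive_cst (p * ((2 - h) ^+ 2 / 4) - 2 * q) v (1 : R))
        (is_derive_exprn_comp _ _ _ 3 Dw))
    (is_deriveM (is_derive_cst (q * (3 * (2 - h) ^+ 2 / 4)) v (1 : R))
        (is_derive_exprn_comp _ _ _ 5 Dw))).
rewrite (@continuous_FTC2_oo _ _ H) //.
(* At both endpoints [bdry_den] equals [1 - h], while [v - 2^-1] is 1/2 and -1/2. *)
- rewrite /H /bdry_w /bdry_den !(mul0r, mul1r, subrr, subr0, mulr1, sub0r).
  by move: (Num.sqrt _)^-1 => s; field.
- exact: integrable_continuous01.
- by move=> v /subset_itv_oo_cc; exact: cf.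
- apply: continuous_in_subspaceT => v; rewrite inE => vI.
  by apply: derivable1_continuous; case: (DH v vI).
- by move=> v /subset_itv_oo_cc; exact: DH.
Qed.
End boundary.

(** * Values of the symmetrised diagonal integrals *)

Section boundary_values.
Context {R : realType}.
Notation mu := (@lebesgue_measure R).
Implicit Types (h v : R) (i j : nat).
Notation B h i j := (\int[mu]_(v in `]0, 1[) bdry h i j v).

(** On the diagonal x y = w^2 and x + y = (2 - h) w^2 with w = [bdry_w h v], so combinations
    symmetric in x and y become polynomials in w; [p] and [q] are then read off from the
    coefficients of w^3 and w^5. *)
Lemma bdry_sum h i j i' j' (p q : R) : h \in hdom ->
  {in `]0, 1[, forall v, bdry h i j v + bdry h i' j' v =
    (p * ((2 - h) ^+ 2 / 4) - 2 * q) * bdry_w h v ^+ 3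
     + q * (3 * (2 - h) ^+ 2 / 4) * bdry_w h v ^+ 5} ->
  B h i j + B h i' j' = p * (Num.sqrt (1 - h))^-1 + q * (Num.sqrt (1 - h))^-1 ^+ 3.
Proof.
move=> hI E; rewrite -integral_bdry_w// -RintegralD//; [|exact: integrable_bdry..].
by apply: eq_Rintegral => v; rewrite inE; exact: E.
Qed.

Lemma sqr_bdry_wE h v : h \in hdom -> v \in `]0, 1[ ->
  bdry_w h v ^+ 2 = (1 - v * h)^-1 * (1 - (1 - v) * h)^-1.
Proof.
move=> hI /subset_itv_oo_cc vI; have E := sqr_bdry_w h v hI vI.
have d0 := bdry_den_gt0 h v hI vI.
have n0 := lt0r_neq0 d0; rewrite -invfM -/(bdry_den h v).
by apply: (mulIf n0); rewrite E mulVf.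
Qed.

Lemma den_sum h v : h \in hdom -> v \in `]0, 1[ ->
  (1 - v * h)^-1 + (1 - (1 - v) * h)^-1
  = (2 - h) * ((1 - v * h)^-1 * (1 - (1 - v) * h)^-1).
Proof.
move=> hI vI; have vI' : 1 - v \in `]0, 1[ by rewrite itv01_sub1.
have := den_gt _ _ hI (subset_itv_oo_cc vI).
have := den_gt _ _ hI (subset_itv_oo_cc vI') => ? ?.
by field; rewrite !lt0r_neq0; lra.
Qed.

Lemma integral_bdry11 h : h \in hdom ->
  B h 1 1 = 4 / (2 - h) ^+ 2 * (Num.sqrt (1 - h))^-1.
Proof.
move=> hI; have h2 : 2 - h != 0 by move: hI; rewrite in_itv/= => /andP[? ?];
    rewrite lt0r_neq0; lra.
(* The integrand x y w = w^3 is symmetric by itself and is doubled to fit [bdry_sum], with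
   [q = 0]. *)
have S : B h 1 1 + B h 1 1 = 8 / (2 - h) ^+ 2 / Num.sqrt (1 - h)
    + 0 * (Num.sqrt (1 - h))^-1 ^+ 3.
  by apply: bdry_sum => // v vI; rewrite /bdry -/(bdry_w h v) !expr1 -sqr_bdry_wE//; field.
rewrite mul0r addr0 in S.
have -> : 4 / (2 - h) ^+ 2 * (Num.sqrt (1 - h))^-1 = (8 / (2 - h) ^+ 2 / Num.sqrt (1 - h)) / 2.
  by move: (Num.sqrt _)^-1 => s; field.
by rewrite -S; field.
Qed.

Lemma integral_bdry10 h : h \in hdom ->
  B h 1 0 + B h 0 1 = 4 / (2 - h) * (Num.sqrt (1 - h))^-1.
Proof.
move=> hI; have h2 : 2 - h != 0 by move: hI; rewrite in_itv/= => /andP[? ?];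
    rewrite lt0r_neq0; lra.
rewrite -[RHS]addr0 -[X in _ = _ + X](mul0r ((Num.sqrt (1 - h))^-1 ^+ 3)).
apply: bdry_sum => // v vI.
rewrite /bdry -/(bdry_w h v) !expr0 !expr1 mulr1 mul1r -mulrDl den_sum// -sqr_bdry_wE//.
by field.
Qed.

(** Here x^2 + y^2 = (x + y)^2 - 2 x y. The coefficient of w^5 forces [q] to be 4/3, and that of w^3
    then gives [p]. *)
Lemma integral_bdry20 h : h \in hdom ->
  B h 2 0 + B h 0 2 = 8 / (3 * (2 - h) ^+ 2) * (Num.sqrt (1 - h))^-1
    + 4 / 3 * (Num.sqrt (1 - h))^-1 ^+ 3.
Proof.
move=> hI; have h2 : 2 - h != 0 by move: hI; rewrite in_itv/= => /andP[? ?];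
    rewrite lt0r_neq0; lra.
apply: bdry_sum => // v vI.
rewrite /bdry -/(bdry_w h v) !expr0 mulr1 mul1r -mulrDl.
have -> : (1 - v * h)^-1 ^+ 2 + (1 - (1 - v) * h)^-1 ^+ 2
    = ((2 - h) * bdry_w h v ^+ 2) ^+ 2 - 2 * bdry_w h v ^+ 2.
  by rewrite sqr_bdry_wE// -den_sum//; ring.
by field.
Qed.
End boundary_values.

(** * Calculus of theta, and its action on combinations of moments *)

Section theta.
Context {R : realType}.
Implicit Types (f g : R -> R) (h c : R).

(** A derivative depends only on the germ, and [hdom] is open. *)
Lemma eq_theta f g h : h \in hdom -> {in hdom, f =1 g} -> theta f h = theta g h.
Proof.
move=> hI fg; rewrite /theta !derive1E; congr (_ * _); apply: near_eq_derive.
by near=> x; apply: fg; near: x; exact: near_in_itvoo.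
Unshelve. all: by end_near. Qed.

Lemma eq_derivable f g h : h \in hdom -> {in hdom, f =1 g} ->
  derivable f h 1 -> derivable g h 1.
Proof.
move=> hI fg; apply: near_eq_derivable.
by near=> x; apply: fg; near: x; exact: near_in_itvoo.
Unshelve. all: by end_near. Qed.

Lemma thetaD f g h : derivable f h 1 -> derivable g h 1 ->
  theta (fun x => f x + g x) h = theta f h + theta g h.
Proof. by move=> df dg; rewrite /theta !derive1E -mulrDr -(deriveD df dg). Qed.

Lemma thetaZ c f h : derivable f h 1 -> theta (fun x => c * f x) h = c * theta f h.
Proof. by move=> df; rewrite /theta !derive1E mulrCA (deriveZ c df). Qed.

(** Multiplies out (2 t + 1)(2 t^2 + 2 t + 1) and (t + 1)^3 for t = theta; the derivability
    hypotheses justify the linearity of theta. *)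
Lemma Lop_expand f h : {in hdom, forall x, derivable f x 1} ->
  {in hdom, forall x, derivable (theta f) x 1} ->
  {in hdom, forall x, derivable (theta (theta f)) x 1} -> h \in hdom ->
  Lop f h = theta (theta (theta f)) h
    - 2^-1 * h * (4 * theta (theta (theta f)) h + 6 * theta (theta f) h
                  + 4 * theta f h + f h)
    + h ^+ 2 * (theta (theta (theta f)) h + 3 * theta (theta f) h
                  + 3 * theta f h + f h).
Proof.
move=> d0 d1 d2 hI; rewrite /Lop.
have dZ c g x : derivable g x 1 -> derivable (fun x => c * g x) x 1.
  by move=> dg; exact: (derivableZ dg).
have dD g k x : derivable g x 1 -> derivable k x 1 -> derivable (fun x => g x + k x) x 1.
  by move=> dg dk; exact: (derivableD dg dk).
have tA : theta (fun h => 2 * theta (theta f) h + 2 * theta f h + f h) h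
    = 2 * theta (theta (theta f)) h + 2 * theta (theta f) h + theta f h.
  rewrite (thetaD (fun h => 2 * theta (theta f) h + 2 * theta f h) f);
      [|by apply: (dD (fun h => 2 * theta (theta f) h));
          apply: dZ; [exact: d2|exact: d1]|exact: d0].
  rewrite (thetaD (fun h => 2 * theta (theta f) h)); [|by apply: dZ;
      exact: d2|by apply: dZ; exact: d1].
  by rewrite !thetaZ; [|exact: d1|exact: d2].
(* This is proved on all of [hdom] because [tB2] applies theta to it again. *)
have tB1 : {in hdom, theta (fun h => theta f h + f h)
    =1 (fun h => theta (theta f) h + theta f h)}.
  by move=> x xI; rewrite thetaD; [|exact: d1|exact: d0].
have tB2 : theta (fun h => theta (fun h => theta f h + f h) h + (theta f h + f h)) h
    = theta (theta (theta f)) h + 2 * theta (theta f) h + theta f h.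
  rewrite (@eq_theta _ (fun h => (theta (theta f) h + theta f h) + (theta f h + f h)))//;
      last first.
    by move=> x xI; rewrite tB1.
  rewrite (thetaD (fun h => theta (theta f) h + theta f h) (fun h => theta f h + f h)).
  - rewrite (thetaD (theta (theta f))) ?(thetaD (theta f));
      [|exact: d1|exact: d0|exact: d2|exact: d1].
    move: (theta (theta (theta f)) h) (theta (theta f) h) (theta f h) => a b c.
    by ring.
  - by apply: dD; [exact: d2|exact: d1].
  - by apply: dD; [exact: d1|exact: d0].
rewrite tA tB2 tB1//.
move: (theta (theta (theta f)) h) (theta (theta f) h) (theta f h) (f h) => a b c d.
by field.
Qed.

(* A linear combination of moments is a list of weighted index pairs, so that
   iterating [theta] on [Y] becomes a computation on lists. *)
Definition moment_comb (s : seq (R * (nat * nat))) h : R :=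
  \sum_(t <- s) t.1 * moment t.2.1 t.2.2 h.

(** Transcribes [theta_moment]: the third entry merges its two negative terms, as (i + 1/2) + (j +
    1/2) = i + j + 1. *)
Definition theta_comb (s : seq (R * (nat * nat))) : seq (R * (nat * nat)) :=
  flatten [seq [:: (t.1 * (t.2.1%:R + 2^-1), (t.2.1.+1, t.2.2));
                   (t.1 * (t.2.2%:R + 2^-1), (t.2.1, t.2.2.+1));
                   (- t.1 * (t.2.1%:R + t.2.2%:R + 1), t.2)] | t <- s].

Lemma derivable_moment i j h : h \in hdom -> derivable (moment i j) h 1.
Proof. by move=> hI; case: (is_derive_moment i j h hI). Qed.

Lemma derivable_moment_comb s h : h \in hdom -> derivable (moment_comb s) h 1.
Proof.
move=> hI; elim: s => [|t s IH].
  have -> : moment_comb [::] = cst 0 by apply/funext => x; rewrite /moment_comb big_nil.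
  exact: derivable_cst.
have -> : moment_comb (t :: s) = (t.1 *: moment t.2.1 t.2.2 + moment_comb s).
  by apply/funext => x; rewrite /moment_comb big_cons.
by apply: derivableD => //; apply: derivableZ; exact: derivable_moment.
Qed.

Lemma theta_moment_comb s h : h \in hdom -> theta (moment_comb s) h = moment_comb (theta_comb s) h.
Proof.
move=> hI; elim: s => [|t s IH].
  have -> : moment_comb [::] = cst 0 by apply/funext => x; rewrite /moment_comb big_nil.
  by rewrite /theta derive1_cst mulr0.
have -> : moment_comb (t :: s) = (fun x => t.1 * moment t.2.1 t.2.2 x + moment_comb s x).
  by apply/funext => x; rewrite /moment_comb big_cons.
rewrite (thetaD (fun x => t.1 * moment t.2.1 t.2.2 x) (moment_comb s)).
- rewrite (thetaZ _ (moment t.2.1 t.2.2)); last exact: derivable_moment.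
  rewrite theta_moment// IH /moment_comb /theta_comb /= !big_cons /=.
  move: (bigop _ _ _) (moment t.2.1.+1 _ h) (moment t.2.1 t.2.2.+1 h)
      (moment t.2.1 t.2.2 h) => S a b c.
  by field.
- by apply: derivableZ; exact: derivable_moment.
- exact: derivable_moment_comb.
Qed.
End theta.

(** * The differential equation for [Y] *)

Lemma Y_moment_comb (R : realType) : {in hdom, @Y R =1 moment_comb [:: (1, (0%N, 0%N))]}.
Proof.
move=> h hI; rewrite /moment_comb big_cons big_nil addr0 mul1r.
apply: eq_Rintegral => p; rewrite inE => tp.
have p1 := triangle_fst _ tp.
have p2 : 1 - p.2 \in `]0, 1[ by rewrite itv01_sub1 triangle_snd.
rewrite /Yintegrand /kern !expr0 !mul1r -invfM -sqrtrM ?ltW ?rad_gt0//.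
by rewrite subKr; congr (Num.sqrt _)^-1; ring.
Qed.

Lemma theta_Y (R : realType) : let s0 := [:: (1 : R, (0%N, 0%N))] in
  [/\ {in hdom, theta (@Y R) =1 moment_comb (theta_comb s0)},
      {in hdom, theta (theta (@Y R)) =1 moment_comb (theta_comb (theta_comb s0))}
    & {in hdom, theta (theta (theta (@Y R)))
        =1 moment_comb (theta_comb (theta_comb (theta_comb s0)))}].
Proof.
move=> s0.
have t1 : {in hdom, theta (@Y R) =1 moment_comb (theta_comb s0)}.
  by move=> x xI; rewrite (eq_theta _ _ _ xI (@Y_moment_comb R)) theta_moment_comb.
have t2 : {in hdom, theta (theta (@Y R)) =1 moment_comb (theta_comb (theta_comb s0))}.
  by move=> x xI; rewrite (eq_theta _ _ _ xI t1) theta_moment_comb.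
split=> // x xI; by rewrite (eq_theta _ _ _ xI t2) theta_moment_comb.
Qed.

Lemma derivable_theta_Y (R : realType) (h : R) : h \in hdom ->
  [/\ derivable (@Y R) h 1, derivable (theta (@Y R)) h 1
    & derivable (theta (theta (@Y R))) h 1].
Proof.
move=> hI; have [t1 t2 _] := @theta_Y R.
have D s g : {in hdom, g =1 moment_comb s} -> derivable g h 1.
  move=> gs; apply: (eq_derivable (moment_comb s)) => //; first by move=> x xI; rewrite gs.
  exact: derivable_moment_comb.
by split; [exact: D (@Y_moment_comb R)|exact: D t1|exact: D t2].
Qed.

(** [Lop] applied to [Y] involves the ten moments with i + j at most 3. The six relations among
    these moments reduce it to diagonal integrals in symmetric pairs, whose values are known. *)
Lemma Lop_Y (R : realType) (h : R) : h \in hdom -> Lop (@Y R) h = rhs h.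
Proof.
move=> hI; have [t1 t2 t3] := @theta_Y R.
rewrite Lop_expand//; [|by move=> x /derivable_theta_Y[]..].
rewrite Y_moment_comb// t1// t2// t3//.
have r10 := moment_rel_fst 0 0 h hI; have r01 := moment_rel_snd 0 0 h hI.
have r20 := moment_rel_fst 1 0 h hI; have r02 := moment_rel_snd 0 1 h hI.
have r11 := moment_rel_fst 0 1 h hI; have r11' := moment_rel_snd 1 0 h hI.
have b11 := integral_bdry11 h hI; have b10 := integral_bdry10 h hI;
    have b20 := integral_bdry20 h hI.
rewrite /moment_comb /theta_comb /= !big_cons !big_nil /=.
move: (hI); rewrite in_itv/= => /andP[h0 h1].
have s1 : Num.sqrt (1 - h) ^+ 2 = 1 - h by rewrite sqr_sqrtr; lra.
have s0' : 0 < Num.sqrt (1 - h) by rewrite sqrtr_gt0; lra.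
rewrite /rhs.
move: (Num.sqrt (1 - h)) b11 b10 b20 s1 s0' => s.
move: r10 r01 r20 r02 r11 r11'.
(* Each pattern captures the first integral not yet named, so the order of the relations just
   generalized fixes the meaning of the names. *)
set b10 := Rintegral _ _ _; set b01 := Rintegral _ _ _; set b20 := Rintegral _ _ _.
set b02 := Rintegral _ _ _; set b11 := Rintegral _ _ _.
move: b11 b10 b01 b20 b02.
move: (moment 0 0 h) (moment 1 0 h) (moment 0 1 h) (moment 2 0 h) (moment 1 1 h)
    (moment 0 2 h) (moment 3 0 h) (moment 2 1 h) (moment 1 2 h) (moment 0 3 h).
move=> J00 J10 J01 J20 J11 J02 J30 J21 J12 J03 b11 b10 b01 b20 b02
  r10 r01 r20 r02 r11 r11' v11 v10 v20 s2 s_gt0.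
set L := (X in X = _).
(* The multipliers are found by matching the moments of top order. *)
have -> : L = h * (- (3 / 4) * (1 - h) * (b20 + b02 + (b11 + b11))
                   + (2 - h) / 2 * (b10 + b01)).
  have -> : h * (- (3 / 4) * (1 - h) * (b20 + b02 + (b11 + b11)) + (2 - h) / 2 * (b10 + b01))
    = - (3 / 4) * (1 - h) * (h * b20 + h * b02 + (h * b11 + h * b11))
      + (2 - h) / 2 * (h * b10 + h * b01) by ring.
  (* Both [r11] and [r11'] have right-hand side [h * b11]; each replaces one of its two copies. *)
  rewrite -r10 -r01 -r20 -r02 -{1}r11 -r11' /L.
  by field.
rewrite v11 v10 v20.
(* In terms of s = sqrt(1 - h) the remaining identity is rational, with 2 - h = 1 + s^2 nonzero. *)
have -> : h = 1 - s ^+ 2 by rewrite s2 subKr.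
have n0 : s != 0 by rewrite lt0r_neq0.
have n1 : 2 - (1 - s ^+ 2) != 0 by rewrite lt0r_neq0//; nra.
by field; rewrite n0 n1.
Qed.

Local Close Scope classical_set_scope.

Theorem theorem2 (R : realType) :
  \forall h \near (0 : R),
    [/\ derivable (@Y R) h 1, derivable (theta (@Y R)) h 1,
        derivable (theta (theta (@Y R))) h 1
      & Lop (@Y R) h = rhs h].
Proof.
have : \forall h \near (0 : R), h \in hdom.
  by apply: near_in_itvoo; rewrite in_itv/= oppr_lt0 invr_gt0 ltr0n.
apply: filterS => h hI.
by have [d0 d1 d2] := derivable_theta_Y _ _ hI; split=> //; exact: Lop_Y.
Qed.
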